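(* Let the parameters $\tau>1$ and $\mu_0>0$ be chosen so that $1-\frac1\tau-\frac{\mu_0}{4\nu}>0$. Then the noisy-data RIAT algorithm (described in the context) terminates in finitely many steps.
   Context: A discretization level is fixed and suppressed in the notation. The finite-dimensional solution space is identified with $\mathbb R^{n}$ with inner product $\langle\cdot,\cdot\rangle$ and induced norm; $^*$ denotes transpose. Functional: $\mathfrak f:\mathbb R^{n}\to\mathbb R\cup\{+\infty\}$ is proper, lower semicontinuous and $\nu$-strongly convex with $\nu>0$, i.e. $\mathfrak f(\lambda u+(1-\lambda)\bar u)+\nu\lambda(1-\lambda)\|u-\bar u\|^2\le\lambda \mathfrak f(u)+(1-\lambda)\mathfrak f(\bar u)$ for all $u,\bar u\in\operatorname{dom}(\mathfrak f)$, $\lambda\in[0,1]$. Write $P(\zeta):=\arg\min_u\{\mathfrak f(u)-\langle\zeta,u\rangle\}$ (unique minimizer). Data: for $i=1,\dots,q$ let $\mathcal T_i\in\mathbb R^{n\times n}$, with exact data $v_i\in\mathbb R^{n}$ and noisy data $v_i^\delta\in\mathbb R^{n}$, $\|v_i^\delta-v_i\|\le\delta_i$; $\delta_i$ is the noise level and $\delta=(\delta_1^2+\dots+\delta_q^2)^{1/2}$ the total noise. Arnoldi projected systems: let $1\le l\ll n$. Applying $l$ steps of the Arnoldi process to the matrix $\mathcal T_i$ and the vector $v_i^\delta$ gives matrices with $\mathcal T_i\tilde V_{l,i}=\tilde V_{l+1,i}H_i$, where $\tilde V_{l+1,i}\in\mathbb R^{n\times(l+1)}$ has orthonormal columns forming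 a basis of the Krylov space $\operatorname{span}\{v_i^\delta,\mathcal T_iv_i^\delta,\dots,\mathcal T_i^{\,l}v_i^\delta\}$ (powers of $\mathcal T_i$), $\tilde V_{l,i}$ consists of its first $l$ columns, and $H_i\in\mathbb R^{(l+1)\times l}$ is upper Hessenberg. Put $\tilde{\mathcal T}_i^l:=\tilde V_{l+1,i}H_i\tilde V_{l,i}^*$ (from here on the superscript $l$ denotes this approximation, not a power) and assume $\tilde{\mathcal S}:=\{u\in\operatorname{dom}(\mathfrak f):\tilde{\mathcal T}_i^lu=v_i,\ i=1,\dots,q\}\neq\emptyset$. Regularization parameters: $(\gamma_j)_{j\ge0}$ is a monotonically decreasing sequence of positive reals with $\sum_j1/\gamma_j=\infty$. The quantities $\gamma_{k,m}$ and $\gamma_k$ in the algorithm are elements of this one sequence: $\gamma_{k,m}:=\gamma_{\mathfrak z_{k,m}}$ (inner updates) and $\gamma_k:=\gamma_{\mathfrak z_k}$ (outer updates), where $\mathfrak z_{k,m}$, $\mathfrak z_k$ are the total numbers of updates performed up to the inner step $(k,m)$, respectively the outer step $k$. Noisy-data RIAT algorithm. Input: $\tau>1$, $\mu_0>0$, $\mu_1>0$, $\zeta_0\in\mathbb R^{n}$; positive integers $m_0,m_1,\dots$. Set $\zeta_{0,0}^\delta=\zeta_0$, $u_{0,0}^\delta=u_0=P(\zeta_0)$. For $k=0,1,2,\dots$: (inner loop) for $m=0,\dots,m_k-1$: draw $i=i_{k,m}\in\{1,\dots,q\}$ uniformly at random; with $\tilde A=\gamma_{k,m}I+H_iH_i^*$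 set $\tilde h_{k,m}^\delta=\tilde A^{-1/2}\tilde V_{l+1,i}^*(\tilde{\mathcal T}_i^lu_{k,m}^\delta-v_i^\delta)$, $\tilde g_{k,m}^\delta=\tilde V_{l,i}H_i^*\tilde A^{-1}\tilde V_{l+1,i}^*(\tilde{\mathcal T}_i^lu_{k,m}^\delta-v_i^\delta)$; $\tilde t_{k,m}^\delta=\min\{\mu_0\|\tilde h_{k,m}^\delta\|^2/\|\tilde g_{k,m}^\delta\|^2,\mu_1\}$ if $\gamma_{k,m}\|\tilde h_{k,m}^\delta\|^2>\tau^2\delta_i^2$ and $\tilde t_{k,m}^\delta=0$ otherwise; $\zeta_{k,m+1}^\delta=\zeta_{k,m}^\delta-\tilde t_{k,m}^\delta\tilde g_{k,m}^\delta$, $u_{k,m+1}^\delta=P(\zeta_{k,m+1}^\delta)$. (outer step) $\zeta_{k+1}^\delta=\zeta_{k,m_k}^\delta$, $u_{k+1}^\delta=u_{k,m_k}^\delta$. With $K=k+1$, $\tilde A_{K,i}=\gamma_KI+H_iH_i^*$, $\tilde h_{K,i}^\delta=\tilde A_{K,i}^{-1/2}\tilde V_{l+1,i}^*(\tilde{\mathcal T}_i^lu_K^\delta-v_i^\delta)$: if $\gamma_K\|\tilde h_{K,i}^\delta\|^2\le\tau^2\delta_i^2$ for all $i\in\{1,\dots,q\}$, output $u_K^\delta$ and stop. Otherwise compute $\tilde\Delta_K^\delta=\{i:\gamma_K\|\tilde h_{K,i}^\delta\|^2>\tau^2\delta_i^2\}$, $\tilde g_K^\delta=\sum_{i\in\tilde\Delta_K^\delta}\tilde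 V_{l,i}H_i^*\tilde A_{K,i}^{-1/2}\tilde h_{K,i}^\delta$, $\tilde\Phi_K^\delta=\sum_{i\in\tilde\Delta_K^\delta}\|\tilde h_{K,i}^\delta\|^2$; $\tilde t_K^\delta=\min\{\mu_0\tilde\Phi_K^\delta/\|\tilde g_K^\delta\|^2,\mu_1\}$; $\zeta_{K,0}^\delta=\zeta_K^\delta-\tilde t_K^\delta\tilde g_K^\delta$, $u_{K,0}^\delta=P(\zeta_{K,0}^\delta)$, and continue with the next $k$. A step size whose quotient has $\tilde g=0$ in the denominator is $\mu_1$. *)

(* Defs.v *)
From mathcomp Require Import all_boot all_order all_algebra.
From mathcomp Require Import all_classical all_reals all_analysis.

Set Implicit Arguments.
Unset Strict Implicit.
Unset Printing Implicit Defensive.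

Import Order.TTheory GRing.Theory Num.Theory.
Import numFieldNormedType.Exports.

Local Open Scope classical_set_scope.
Local Open Scope ring_scope.

Section Euclidean.
Context {R : realType}.

Definition dotv {n} (u w : 'cV[R]_n) : R := (u^T *m w) 0 0.

(* The library norm `|u| on matrices is the sup norm, hence this definition.
   Both norms induce the canonical topology of 'cV[R]_n. *)
Definition enorm {n} (u : 'cV[R]_n) : R := Num.sqrt (dotv u u).

Definition posdefmx {n} (B : 'M[R]_n) : Prop :=
  B^T = B /\ forall x : 'cV[R]_n, x != 0 -> 0 < dotv x (B *m x).

(* A^{-1/2}: for positive definite A, the unique positive definite square root
   of A^-1 (junk value 0 if there is none). *)
Definition invsqrtmx {n} (A : 'M[R]_n) : 'M[R]_n :=
  xget 0 [set B : 'M[R]_n | posdefmx B /\ B *m B = invmx A].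

End Euclidean.

Section Functionals.
Context {R : realType} {n : nat}.
Implicit Types f : 'cV[R]_n -> \bar R.

Definition dom f : set 'cV[R]_n := [set u | (f u < +oo)%E].

(* f takes values in R u {+oo} and is not identically +oo *)
Definition proper_fun f : Prop :=
  (forall u, f u != -oo%E) /\ dom f !=set0.

(* No factor 1/2 on the modulus nu. *)
Definition strongly_convex (nu : R) f : Prop :=
  forall (u w : 'cV[R]_n) (lam : R), dom f u -> dom f w -> 0 <= lam <= 1 ->
    (f (lam *: u + (1 - lam) *: w)%R
       + (nu * lam * (1 - lam) * enorm (u - w) ^+ 2)%:E
     <= lam%:E * f u + (1 - lam)%:E * f w)%E.

Definition minimizes_tilt f (zeta u : 'cV[R]_n) : Prop :=
  forall w, (f u - (dotv zeta u)%:E <= f w - (dotv zeta w)%:E)%E.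

(* P(zeta) = argmin_u f(u) - <zeta, u>; junk value 0 without a minimizer.
   That the minimizer exists and is unique is not assumed: it follows from f
   being proper, lower semicontinuous and strongly convex. *)
Definition tilt_argmin f (zeta : 'cV[R]_n) : 'cV[R]_n :=
  xget 0 [set u | minimizes_tilt f zeta u].

End Functionals.

Section Arnoldi.
Context {R : realType} {n l : nat}.

Definition krylovmx (T : 'M[R]_n) (v : 'cV[R]_n) : 'M[R]_(n, l.+1) :=
  \matrix_(a < n, j < l.+1) (iter j (mulmx T) v) a 0.

Definition firstcols (V : 'M[R]_(n, l.+1)) : 'M[R]_(n, l) :=
  colsub (widen_ord (leqnSn l)) V.

(* (V, H) is the outcome of l steps of the Arnoldi process without breakdown.
   Column j of the relation T V_l = V_{l+1} H is the j-th Gram-Schmidt step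
   T v_j = sum_{i <= j+1} h_ij v_i; together with the normalised start vector
   and the positive subdiagonal it determines V and H. *)
Record arnoldi (T : 'M[R]_n) (v : 'cV[R]_n)
    (V : 'M[R]_(n, l.+1)) (H : 'M[R]_(l.+1, l)) : Prop := {
  arnoldi_start : enorm v *: col ord0 V = v ;
  arnoldi_rel : T *m firstcols V = V *m H ;
  arnoldi_orthonormal : V^T *m V = 1%:M ;
  (* %MS compares row spaces, hence the transposes *)
  arnoldi_krylov : (V^T == (krylovmx T v)^T)%MS ;
  arnoldi_hessenberg :
    forall (i : 'I_l.+1) (j : 'I_l), (j.+1 < i)%N -> H i j = 0 ;
  arnoldi_subdiag : forall j : 'I_l, 0 < H (lift ord0 j) j
}.

Definition arnoldi_approx (V : 'M[R]_(n, l.+1)) (H : 'M[R]_(l.+1, l)) :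
    'M[R]_n := V *m H *m (firstcols V)^T.

End Arnoldi.

(* Everything the algorithm reads.  in_draw k m is the index drawn at the inner
   step (k, m), so one value of this record is one realization of the draws. *)
Record riat_input (R : realType) (n l q : nat) := RiatInput {
  in_f : 'cV[R]_n -> \bar R ;
  in_V : 'I_q -> 'M[R]_(n, l.+1) ;
  in_H : 'I_q -> 'M[R]_(l.+1, l) ;
  in_vd : 'I_q -> 'cV[R]_n ;
  in_delta : 'I_q -> R ;
  in_gamma : nat -> R ;
  in_tau : R ;
  in_mu0 : R ;
  in_mu1 : R ;
  in_zeta0 : 'cV[R]_n ;
  in_m : nat -> nat ;
  in_draw : nat -> nat -> 'I_q
}.

Section RIAT.
Context {R : realType} {n l q : nat} (D : riat_input R n l q).
Implicit Types (g : R) (i : 'I_q) (u z : 'cV[R]_n) (k m : nat).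

Local Notation P := (tilt_argmin (in_f D)).
Local Notation V := (in_V D).
Local Notation H := (in_H D).
Local Notation mu0 := (in_mu0 D).
Local Notation mu1 := (in_mu1 D).

Definition Amx g i : 'M[R]_l.+1 := g%:M + H i *m (H i)^T.

Definition proj_residual i u : 'cV[R]_l.+1 :=
  (V i)^T *m (arnoldi_approx (V i) (H i) *m u - in_vd D i).

Definition hvec g i u : 'cV[R]_l.+1 :=
  invsqrtmx (Amx g i) *m proj_residual i u.

(* the discrepancy test of equation i is violated *)
Definition active g u i : bool :=
  in_tau D ^+ 2 * in_delta D i ^+ 2 < g * enorm (hvec g i u) ^+ 2.

Definition stepsize (num : R) (d : 'cV[R]_n) : R :=
  if d == 0 then mu1 else Num.min (mu0 * num / enorm d ^+ 2) mu1.

Definition g_inner g i u : 'cV[R]_n :=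
  firstcols (V i) *m (H i)^T *m invmx (Amx g i) *m proj_residual i u.

Definition t_inner g i u : R :=
  if active g u i then stepsize (enorm (hvec g i u) ^+ 2) (g_inner g i u)
  else 0.

Definition g_outer g u : 'cV[R]_n :=
  \sum_(i < q | active g u i)
     firstcols (V i) *m (H i)^T *m invsqrtmx (Amx g i) *m hvec g i u.

Definition Phi_outer g u : R :=
  \sum_(i < q | active g u i) enorm (hvec g i u) ^+ 2.

Definition t_outer g u : R := stepsize (Phi_outer g u) (g_outer g u).

(* Number of updates of zeta made before the inner step (k, m), resp. before
   the outer update number k >= 1: pass j makes m_j inner updates and is
   followed by one outer update.  An update with step size 0 counts. *)
Definition upd_inner k m : nat := ((\sum_(j < k) (in_m D j).+1) + m)%N.
Definition upd_outer k : nat := upd_inner k.-1 (in_m D k.-1).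

Definition gamma_inner k m : R := in_gamma D (upd_inner k m).
Definition gamma_outer k : R := in_gamma D (upd_outer k).

(* zeta_{k,m} when pass k starts from z = zeta_{k,0}; u_{k,m} = P zeta_{k,m} *)
Fixpoint inner_loop k z m : 'cV[R]_n :=
  if m is m'.+1 then
    let zm := inner_loop k z m' in
    let g := gamma_inner k m' in
    let i := in_draw D k m' in
    zm - t_inner g i (P zm) *: g_inner g i (P zm)
  else z.

Definition outer_update k z : 'cV[R]_n :=
  let g := gamma_outer k in z - t_outer g (P z) *: g_outer g (P z).

(* zeta_{k,0} *)
Fixpoint zeta_start k : 'cV[R]_n :=
  if k is k'.+1 then
    outer_update k (inner_loop k' (zeta_start k') (in_m D k'))
  else in_zeta0 D.

(* zeta_k and u_k, for k >= 1 *)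
Definition zeta_outer k : 'cV[R]_n :=
  inner_loop k.-1 (zeta_start k.-1) (in_m D k.-1).
Definition u_outer k : 'cV[R]_n := P (zeta_outer k).

Definition stop_at k : Prop :=
  forall i, gamma_outer k * enorm (hvec (gamma_outer k) i (u_outer k)) ^+ 2
            <= in_tau D ^+ 2 * in_delta D i ^+ 2.

(* The iterates above are defined for all k, as if the stopping test were never
   obeyed; the algorithm coincides with them up to the first k >= 1 where the
   test succeeds, and halts there. *)
Definition riat_terminates : Prop := exists2 k, (0 < k)%N & stop_at k.

End RIAT.

(* Main.v *)
Require Import Defs.
From mathcomp Require Import all_boot all_order all_algebra.
From mathcomp Require Import all_classical all_reals all_analysis.
From mathcomp Require Import complex ring lra.

Import Order.TTheory GRing.Theory Num.Theory.
Import numFieldNormedType.Exports.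

Local Open Scope classical_set_scope.
Local Open Scope ring_scope.

(* The Lyapunov function is the Bregman distance
     E(zeta) = f(uh) - f(u) - <zeta, uh - u>,  u = P(zeta),
   to a solution uh of the projected systems. Strong convexity gives
     E(zeta - d) <= E(zeta) - <d, u - uh> + ||d||^2 / (4 nu).
   For an update d = t g built from active equations only, with
   Phi = sum_i ||h_i||^2 over these equations, the discrepancy test yields
   <g, u - uh> >= (1 - 1/tau) Phi and the step size rule t ||g||^2 <= mu0 Phi,
   so E drops by at least (1 - 1/tau - mu0/(4 nu)) t Phi. Moreover
   ||g||^2 <= q Phi bounds t below, and an active equation i has
   ||h_i||^2 > tau^2 delta_i^2 / gamma_0 because gamma is nonincreasing. Hence
   every outer step that does not stop lowers E >= 0 by a fixed amount. *)

(** * The Euclidean inner product and norm on column vectors *)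

Section DotProduct.
Context {R : realType}.

Lemma dotvE {n} (u w : 'cV[R]_n) : dotv u w = \sum_i u i 0 * w i 0.
Proof. by rewrite /dotv mxE; apply: eq_bigr => i _; rewrite mxE. Qed.

Lemma dotvC {n} (u w : 'cV[R]_n) : dotv u w = dotv w u.
Proof. by rewrite !dotvE; apply: eq_bigr => i _; rewrite mulrC. Qed.

Lemma dotvDr {n} (u w x : 'cV[R]_n) : dotv u (w + x) = dotv u w + dotv u x.
Proof. by rewrite /dotv mulmxDr mxE. Qed.

Lemma dotvZr {n} a (u w : 'cV[R]_n) : dotv u (a *: w) = a * dotv u w.
Proof. by rewrite /dotv -scalemxAr mxE. Qed.

Lemma dotvNr {n} (u w : 'cV[R]_n) : dotv u (- w) = - dotv u w.
Proof. by rewrite -scaleN1r dotvZr mulN1r. Qed.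

Lemma dotvDl {n} (u w x : 'cV[R]_n) : dotv (u + w) x = dotv u x + dotv w x.
Proof. by rewrite dotvC dotvDr !(dotvC x). Qed.

Lemma dotvZl {n} a (u w : 'cV[R]_n) : dotv (a *: u) w = a * dotv u w.
Proof. by rewrite dotvC dotvZr dotvC. Qed.

Lemma dotvNl {n} (u w : 'cV[R]_n) : dotv (- u) w = - dotv u w.
Proof. by rewrite dotvC dotvNr dotvC. Qed.

Lemma dotv0 {n} (u : 'cV[R]_n) : dotv u 0 = 0.
Proof. by rewrite /dotv mulmx0 mxE. Qed.

Lemma dotv_mulmxl {n p} (M : 'M[R]_(n, p)) u w :
  dotv (M *m u) w = dotv u (M^T *m w).
Proof. by rewrite /dotv trmx_mul mulmxA. Qed.

Lemma dotv_suml {n} (I : finType) (Q : pred I) (x : I -> 'cV[R]_n) w :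
  dotv (\sum_(i | Q i) x i) w = \sum_(i | Q i) dotv (x i) w.
Proof.
apply: (big_ind2 (fun y z => dotv y w = z)) => //; first by rewrite dotvC dotv0.
by move=> y a z b <- <-; rewrite dotvDl.
Qed.

Lemma dotvv_ge0 {n} (u : 'cV[R]_n) : 0 <= dotv u u.
Proof. by rewrite dotvE sumr_ge0// => i _; rewrite -expr2 sqr_ge0. Qed.

Lemma dotvv_gt0 {n} (u : 'cV[R]_n) : (0 < dotv u u) = (u != 0).
Proof.
rewrite lt0r dotvv_ge0 andbT; congr (~~ _); apply/eqP/eqP => [|->]; last first.
  exact: dotv0.
rewrite dotvE => /eqP.
rewrite psumr_eq0 => [/allP u0|i _]; last by rewrite -expr2 sqr_ge0.
apply/colP => i; have := u0 i; rewrite mem_index_enum => /(_ isT).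
by rewrite /= mulf_eq0 orbb mxE => /eqP.
Qed.

Lemma sqr_enorm {n} (u : 'cV[R]_n) : enorm u ^+ 2 = dotv u u.
Proof. by rewrite sqr_sqrtr ?dotvv_ge0. Qed.

Lemma enorm_ge0 {n} (u : 'cV[R]_n) : 0 <= enorm u.
Proof. exact: sqrtr_ge0. Qed.

Lemma ler_enorm {n p} (u : 'cV[R]_n) (w : 'cV[R]_p) :
  (enorm u <= enorm w) = (dotv u u <= dotv w w).
Proof. by rewrite ler_sqrt// dotvv_ge0. Qed.

Lemma ler_coord_enorm {n} (u : 'cV[R]_n) i : `|u i 0| <= enorm u.
Proof.
rewrite -sqrtr_sqr ler_sqrt ?dotvv_ge0// dotvE (bigD1 i)//= -expr2 lerDl.
by rewrite sumr_ge0// => j _; rewrite -expr2 sqr_ge0.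
Qed.

Lemma cauchy_schwarz {n} (u w : 'cV[R]_n) : dotv u w <= enorm u * enorm w.
Proof.
have [->|w0] := eqVneq w 0.
  by rewrite dotv0 mulr_ge0 ?enorm_ge0.
rewrite (le_trans (ler_norm _))// -sqrtr_sqr -sqrtrM ?dotvv_ge0//.
have ww : 0 < dotv w w by rewrite dotvv_gt0.
rewrite ler_sqrt ?mulr_ge0 ?dotvv_ge0//.
(* This vector is [dotv w w] times the component of [u] orthogonal to [w]; its squared norm is
   [dotv w w] times the Gram determinant. *)
have := dotvv_ge0 (dotv w w *: u - dotv u w *: w).
rewrite !(dotvDl, dotvDr, dotvNl, dotvNr, dotvZl, dotvZr) (dotvC w u).
rewrite (_ : _ + _ = dotv w w * (dotv u u * dotv w w - dotv u w ^+ 2)); last ring.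
by rewrite pmulr_rge0// subr_ge0.
Qed.

(** Expand into pairs and use 2<a, b> <= |a|^2 + |b|^2 on each. Vectors outside [Q] are replaced by
    0, so the factor counts the whole index type. *)
Lemma dotv_sum_le {n} (I : finType) (Q : pred I) (x : I -> 'cV[R]_n) :
  dotv (\sum_(i | Q i) x i) (\sum_(i | Q i) x i)
  <= #|I|%:R * \sum_(i | Q i) dotv (x i) (x i).
Proof.
pose y i := if Q i then x i else 0.
have -> : \sum_(i | Q i) x i = \sum_i y i by rewrite big_mkcond.
have -> : \sum_(i | Q i) dotv (x i) (x i) = \sum_i dotv (y i) (y i).
  by rewrite big_mkcond; apply: eq_bigr => i _; rewrite /y; case: ifP; rewrite ?dotv0.
have -> : dotv (\sum_i y i) (\sum_i y i) = \sum_i \sum_j dotv (y j) (y i).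
  by rewrite dotv_suml; apply: eq_bigr => i _; rewrite dotvC dotv_suml.
apply: (@le_trans _ _
    (\sum_i \sum_j (dotv (y i) (y i) / 2 + dotv (y j) (y j) / 2))).
  apply: ler_sum => i _; apply: ler_sum => j _.
  have := dotvv_ge0 (y i - y j).
  rewrite !(dotvDl, dotvDr, dotvNl, dotvNr) (dotvC (y j) (y i)); lra.
set S := \sum_i dotv (y i) (y i).
under eq_bigr do rewrite big_split/= sumr_const -mulr_suml -/S.
by rewrite big_split/= sumr_const sumrMnl -mulr_suml -/S -mulrnDl -splitr mulr_natl.
Qed.

(** [W *m W^T] is an orthogonal projection, so the squared norm of [x - W *m (W^T *m x)] equals
    |x|^2 - |W^T x|^2. *)
Lemma enorm_trmx_le {n p} (W : 'M[R]_(n, p)) (x : 'cV[R]_n) :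
  W^T *m W = 1%:M -> enorm (W^T *m x) <= enorm x.
Proof.
move=> WW; rewrite ler_enorm.
have := dotvv_ge0 (x - W *m (W^T *m x)).
rewrite !(dotvDl, dotvDr, dotvNl, dotvNr) !(dotvC x (W *m _)) !dotv_mulmxl.
rewrite (mulmxA W^T W) WW mul1mx.
lra.
Qed.

End DotProduct.

(** * Existence of the inverse square root of a positive definite matrix *)

Section SquareRoot.
Context {R : realType}.

(** Newton interpolation: a new node is matched by adding a multiple of the polynomial [w] that
    vanishes at the earlier nodes. *)
Lemma interpolation {F : fieldType} (s : seq F) (h : F -> F) :
  exists p : {poly F}, {in s, forall x, p.[x] = h x}.
Proof.
elim: s => [|a s [p ph]]; first by exists 0.
have [as_|as_] := boolP (a \in s).
  by exists p => x; rewrite inE => /predU1P[->|]; exact: ph.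
pose w := \prod_(b <- s) ('X - b%:P).
have wa : w.[a] != 0 by rewrite -/(root _ _) root_prod_XsubC.
exists (p + ((h a - p.[a]) / w.[a])%:P * w) => x.
rewrite inE !hornerE => /predU1P[->|xs]; first by rewrite divfK// addrC subrK.
have /rootP -> : root w x by rewrite root_prod_XsubC.
by rewrite mulr0 addr0 ph.
Qed.

Lemma trmx_horner_mx {n} {A : 'M[R]_n.+1} p : A^T = A ->
  (horner_mx A p)^T = horner_mx A p.
Proof.
move=> AT; elim/poly_ind: p => [|p c IH]; first by rewrite rmorph0 trmx0.
rewrite rmorphD rmorphM /= horner_mx_X horner_mx_C linearD /= tr_scalar_mx.
by rewrite trmx_mul AT IH (comm_mx_horner p (erefl (A *m A))).
Qed.

Lemma posdefmx_root_gt0 {n} {A : 'M[R]_n} {a} :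
  posdefmx A -> root (char_poly A) a -> 0 < a.
Proof.
case=> AT Apos; rewrite -eigenvalue_root_char => /eigenvalueP[x xA x0].
have xT0 : x^T != 0 by rewrite -(inj_eq trmx_inj) trmxK trmx0.
have := Apos _ xT0; rewrite -[A in A *m _]AT -trmx_mul xA linearZ/= dotvZr.
by rewrite pmulr_lgt0// dotvv_gt0.
Qed.

(* A symmetric real matrix is diagonalizable over R[i] with real spectrum, so a
   real polynomial vanishing on that spectrum annihilates it. *)
Lemma symmetric_horner_eq0 {n} {A : 'M[R]_n.+1} : A^T = A ->
  exists2 s : seq R, all (root (char_poly A)) s &
    forall p : {poly R}, {in s, forall x, p.[x] = 0} -> horner_mx A p = 0.
Proof.
move=> AT; pose AC := map_mx (real_complex R) A.
have ACherm : AC \is hermsymmx.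
  apply: realsym_hermsym.
    apply/is_hermitianmxP; rewrite expr0 scale1r.
    by apply/matrixP => i j; rewrite !mxE -{1}AT mxE.
  by apply/mxOverP => i j; rewrite mxE; apply/complex_realP; exists (A i j).
have ACE : AC = invmx (spectralmx AC) *m diag_mx (spectral_diag AC) *m spectralmx AC.
  exact/orthomx_spectralP/hermitian_normalmx.
have dreal := hermitian_spectral_diag_real ACherm.
set P := spectralmx AC in ACE; set d := spectral_diag AC in ACE dreal.
have Pu : P \in unitmx by exact: spectral_unit.
pose e j := complex.Re (d 0 j).
have de j : d 0 j = (e j)%:C%C by rewrite RRe_real// (mxOverP _ _).
exists [seq e j | j <- enum 'I_n.+1] => [|p pe].
  apply/allP => _ /mapP[j _ ->].
  (* Each row of the invertible matrix [P] is a left eigenvector of [AC], with eigenvalue the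
     corresponding entry of [d]. *)
  rewrite -(fmorph_root (real_complex R)) map_char_poly -eigenvalue_root_char.
  apply/eigenvalueP; exists (row j P).
    rewrite -/AC -row_mul ACE !mulmxA mulmxV// mul1mx row_mul row_diag_mx.
    by rewrite -scalemxAl -rowE de.
  apply/eqP; rewrite rowE => /(congr1 (mulmx^~ (invmx P))).
  rewrite mulmxK// mul0mx => /rowP/(_ j); rewrite !mxE !eqxx => /eqP.
  by rewrite oner_eq0.
apply: (map_mx_inj (f := real_complex R)); rewrite map_mx0 map_horner_mx -/AC ACE.
rewrite horner_mx_uconjC// horner_mx_diag.
rewrite (_ : map_mx _ _ = 0) ?raddf0 ?mulmx0 ?mul0mx//.
apply/rowP => j; rewrite !mxE de horner_map /= pe// ?rmorph0//.
by apply: map_f; rewrite mem_enum.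
Qed.

Lemma posdefmx_unit {n} {A : 'M[R]_n} : posdefmx A -> A \in unitmx.
Proof.
case=> AT Apos; rewrite -row_free_unit -kermx_eq0; apply/eqP/row_matrixP => i.
apply/eqP; rewrite row0; apply: contraT => x0.
have := Apos (row i (kermx A))^T; rewrite -[A in A *m _]AT -trmx_mul.
rewrite -row_mul mulmx_ker row0 trmx0 dotv0 ltxx.
by rewrite -(inj_eq trmx_inj) trmxK trmx0 x0 => /(_ isT).
Qed.

(** Let [r] interpolate x^(-1/4) on the spectrum and put C = r(A). Then C is symmetric and C^4 A =
    1, so B = C^2 squares to A^-1. Taking a fourth root makes B visibly positive definite: <x, B x>
    = |C x|^2. *)
Lemma invsqrtmxP {n} {A : 'M[R]_n.+1} : posdefmx A ->
  posdefmx (invsqrtmx A) /\ invsqrtmx A *m invsqrtmx A = invmx A.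
Proof.
move=> Apos; apply: (xgetPex 0 (P := [set B | posdefmx B /\ B *m B = invmx A])).
have AT := Apos.1; have Au := posdefmx_unit Apos.
have [s /allP sA sP] := symmetric_horner_eq0 AT.
have [r rs] := interpolation s (fun x => Num.sqrt (Num.sqrt x^-1)).
have Cr4 : horner_mx A (r ^+ 4 * 'X - 1) = 0.
  apply: sP => x xs; rewrite !hornerE rs//.
  have x0 : 0 < x by exact: posdefmx_root_gt0 Apos (sA _ xs).
  rewrite -[4%N]/(2 * 2)%N exprM !sqr_sqrtr ?sqrtr_ge0 ?invr_ge0 ?ltW//.
  by rewrite mulVf ?subrr ?gt_eqF.
pose C := horner_mx A r.
have CT : C^T = C by exact: trmx_horner_mx.
have CCCCA : C *m C *m (C *m C) *m A = 1%:M.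
  move: Cr4; rewrite rmorphB rmorphM rmorphXn rmorph1 /= horner_mx_X -/C.
  by move/eqP; rewrite subr_eq0 => /eqP; apply: etrans; rewrite -[4%N]/(2 + 2)%N exprD expr2.
exists (C *m C); split; last first.
  by rewrite -[RHS]mul1mx -CCCCA mulmxK.
split=> [|x x0]; first by rewrite trmx_mul CT.
rewrite -[_ *m _ *m x]mulmxA -{1}CT -dotv_mulmxl dotvv_gt0.
apply: contra x0 => /eqP Cx; rewrite -[x]mul1mx -(mulmx1C CCCCA).
by rewrite -!mulmxA Cx !mulmx0.
Qed.

End SquareRoot.

(** * Strongly convex lower semicontinuous functions and their minimizers *)

Section StrongConvexity.
Context {R : realType} {n : nat}.
Implicit Types f : 'cV[R]_n -> \bar R.

Lemma ball_enorm (x y : 'cV[R]_n) e : 0 < e -> enorm (x - y) < e -> ball x e y.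
Proof.
move=> e0 xye; split=> // i j; rewrite ord1.
by apply: le_lt_trans xye; have := ler_coord_enorm (x - y) i; rewrite !mxE.
Qed.

Lemma continuous_dotv (zeta : 'cV[R]_n) : continuous (dotv zeta).
Proof.
rewrite (_ : dotv zeta = fun w => \sum_i zeta i 0 * w i 0); last first.
  by apply/funext => w; exact: dotvE.
move=> u; rewrite /continuous_at /=.
have FF := nbhs_filter u.
apply: cvg_big => [|i _]; first exact: add_continuous.
by apply: cvgMr; exact: coord_continuous.
Qed.

Lemma proper_funE {f} u : proper_fun f -> dom f u -> f u = (fine (f u))%:E.
Proof.
case=> /(_ u) fNy _; rewrite /dom /= => fy.
by rewrite fineK// fin_numE fNy /=; apply: contraTneq fy => ->.
Qed.

Lemma strongly_convex_fine {f nu} u w lam : proper_fun f ->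
    strongly_convex nu f -> dom f u -> dom f w -> 0 <= lam <= 1 ->
  dom f (lam *: u + (1 - lam) *: w) /\
  fine (f (lam *: u + (1 - lam) *: w)) + nu * lam * (1 - lam) * dotv (u - w) (u - w)
    <= lam * fine (f u) + (1 - lam) * fine (f w).
Proof.
move=> fp fsc fu fw lam01; have := fsc u w lam fu fw lam01.
rewrite (proper_funE u fp fu) (proper_funE w fp fw) sqr_enorm.
have := fp.1 (lam *: u + (1 - lam) *: w); rewrite /dom /=.
by case: (f _) => [r| |]//= _; rewrite -!EFinM -!EFinD lee_fin ltry.
Qed.

(* Evaluating the convexity inequality on the segment from [x0] to [u], at a
   point of a ball around [x0] on which [f] exceeds [f x0 - 1], bounds [f u]
   below by a quadratic in [enorm (u - x0)]. *)
Lemma strongly_convex_lbound {f nu} : 0 < nu -> proper_fun f ->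
    lower_semicontinuous f -> strongly_convex nu f ->
  exists M, forall u, dom f u -> M <= fine (f u).
Proof.
move=> nu0 fp flsc fsc; have [x0 fx0] := fp.2.
have [|U /nbhs_ballP[r /= r0 rU] Uf] := flsc x0 (fine (f x0) - 1).
  by rewrite [ltRHS](proper_funE _ fp)// lte_fin; lra.
(* The quadratic nu/2 N^2 - 2(N + r)/r in N has minimum -2 - 2/(nu r^2), attained at N = 2/(r
   nu). *)
exists (fine (f x0) - 2 - 2 / (nu * r ^+ 2)) => u fu.
pose N := enorm (u - x0); have N0 : 0 <= N by exact: enorm_ge0.
have Nr0 : 0 < N + r by lra.
(* This choice gives both [lam <= 2^-1] and [lam * N < r], so the point [w] of the segment lies in
   the ball. *)
pose lam := r / (2 * (N + r)).
have lamE : lam * (2 * (N + r)) = r by rewrite /lam divfK// gt_eqF// mulr_gt0.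
have lam0 : 0 < lam by rewrite divr_gt0// mulr_gt0.
have lam12 : lam <= 2^-1.
  by rewrite ler_pdivrMr ?mulr_gt0// mulrA mulVf// mul1r; lra.
have lamN : lam * N < r by nra.
have lam01 : 0 <= lam <= 1 by lra.
have [fw fwE] := strongly_convex_fine u x0 lam fp fsc fu fx0 lam01.
set w := lam *: u + _ in fw fwE.
have : fine (f x0) - 1 < fine (f w).
  rewrite -lte_fin -[X in (_ < X)%E](proper_funE _ fp)//; apply: Uf; apply: rU.
  apply: ball_enorm => //; rewrite (_ : x0 - w = - lam *: (u - x0)).
    have -> : enorm (- lam *: (u - x0)) = lam * N; last by [].
    rewrite /enorm dotvZl dotvZr -(sqr_enorm (u - x0)) -/N.
    rewrite (_ : - lam * (- lam * N ^+ 2) = (lam * N) ^+ 2); last ring.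
    by rewrite sqrtr_sqr ger0_norm// mulr_ge0// ltW.
  rewrite /w scalerBl scale1r scaleNr scalerBr opprD opprB addrC opprB.
  by rewrite !addrA subrK addrC.
rewrite -sqr_enorm -/N in fwE => fwgt.
have gap : lam * (fine (f u) - fine (f x0)) >= nu * lam * (1 - lam) * N ^+ 2 - 1.
  by lra.
have h1 : nu * lam * (1 - lam) * N ^+ 2 >= lam * (nu / 2 * N ^+ 2).
  have : 0 <= lam * (nu * N ^+ 2) * (2^-1 - lam).
    apply: mulr_ge0; last by rewrite subr_ge0.
    by apply: mulr_ge0; [exact: ltW|rewrite mulr_ge0 ?sqr_ge0// ltW].
  lra.
have h2 : 1 = lam * (2 * (N + r) / r) by rewrite mulrA lamE divff ?gt_eqF.
have {gap h1 h2} : nu / 2 * N ^+ 2 - 2 * (N + r) / r <= fine (f u) - fine (f x0).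
  rewrite -(ler_pM2l lam0); rewrite mulrBr -h2; lra.
have : 0 <= nu / 2 * (N - 2 / (r * nu)) ^+ 2 by rewrite mulr_ge0 ?sqr_ge0//; lra.
rewrite (_ : nu / 2 * _ = nu / 2 * N ^+ 2 - 2 * (N + r) / r + 2 + 2 / (nu * r ^+ 2)).
  lra.
by field; rewrite !gt_eqF.
Qed.

(** The near-infimum sets [B e] generate a Cauchy filter, because convexity at midpoints bounds
    their diameters; lower semicontinuity shows that its limit attains the infimum. *)
Lemma strongly_convex_argmin {f nu} : 0 < nu -> proper_fun f ->
    lower_semicontinuous f -> strongly_convex nu f ->
  exists u, forall w, (f u <= f w)%E.
Proof.
move=> nu0 fp flsc fsc; have [M fM] := strongly_convex_lbound nu0 fp flsc fsc.
pose S := [set fine (f u) | u in dom f].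
have S_lb : has_lbound S by exists M => _ [u fu <-]; exact: fM.
have S_inf : has_inf S.
  by split=> //; have [u fu] := fp.2; exists (fine (f u)), u.
have infS u : dom f u -> inf S <= fine (f u).
  by move=> fu; apply: ge_inf => //; exists u.
pose B (e : R) := [set u | dom f u /\ fine (f u) < inf S + e].
pose F := filter_from [set e : R | 0 < e] B.
have F_filter : Filter F.
  apply: filter_from_filter; first by exists 1 => /=.
  move=> d e /= d0 e0; exists (Num.min d e); first by rewrite /= lt_min d0.
  by move=> u [fu]; rewrite /B /= -ltrBlDl lt_min !ltrBlDl => /andP[].
have F_proper : ProperFilter F.
  apply: filter_from_proper => e /= e0.
  by have [_ [u fu <-] ue] := inf_adherent e0 S_inf; exists u.
have /cauchy_cvg Fcvg : cauchy F.
  (* At the midpoint of x and y the convexity gain is nu/4 |x - y|^2, which must stay below the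
     tolerance nu/4 e^2. *)
  apply: cauchy_exP => e e0; have d0 : 0 < nu * e ^+ 2 / 4.
    by rewrite divr_gt0 ?mulr_gt0 ?exprn_gt0.
  have [_ [x fx <-] xd] := inf_adherent d0 S_inf.
  exists x, (nu * e ^+ 2 / 4) => // y [fy yd].
  apply: ball_enorm => //.
  have half01 : 0 <= (2^-1 : R) <= 1 by lra.
  have [/infS] := strongly_convex_fine x y 2^-1 fp fsc fx fy half01.
  rewrite -sqr_enorm => mid scxy; rewrite -(ltr_pXn2r (n := 2)) ?nnegrE ?enorm_ge0 ?ltW//.
  by rewrite -(ltr_pM2l nu0); lra.
exists (lim F) => w; have [fw|] := boolP (f w < +oo)%E; last first.
  by rewrite -leNgt leye_eq => /eqP ->; rewrite leey.
suff : (f (lim F) <= (inf S)%:E)%E.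
  by move=> /le_trans; apply; rewrite (proper_funE w fp)// lee_fin infS.
apply/lee_addgt0Pr => e e0; rewrite leNgt -EFinD; apply/negP.
(* Otherwise [f] would exceed [inf S + e] on a whole neighbourhood of the limit, which has to meet
   [B e]. *)
move=> /flsc[U /Fcvg FU Uf].
have [u [[fu ue] /Uf]] : exists u, B e u /\ U u.
  by apply: (@filter_ex _ F) => //; apply: filterI => //; exists e.
by rewrite (proper_funE u fp)// lte_fin ltNge ltW.
Qed.

(** On the segment from [u] to [w], minimality of [u] and strong convexity leave the factor nu (1 -
    lam) after division by [lam]; then [lam] tends to 0. *)
Lemma strongly_convex_growth {f nu} u w : 0 < nu -> proper_fun f ->
    strongly_convex nu f -> (forall x, (f u <= f x)%E) -> dom f w ->
  dom f u /\ fine (f u) + nu * dotv (w - u) (w - u) <= fine (f w).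
Proof.
move=> nu0 fp fsc umin fw; have fu : dom f u := le_lt_trans (umin w) fw.
split=> //; set E := dotv _ _; rewrite -lerBrDl; apply/ler_addgt0Pr => e e0.
have le_lam lam : 0 < lam < 1 -> nu * (1 - lam) * E <= fine (f w) - fine (f u).
  move=> lam01; have lam01' : 0 <= lam <= 1 by lra.
  have [fx fxE] := strongly_convex_fine w u lam fp fsc fw fu lam01'.
  have := umin (lam *: w + (1 - lam) *: u).
  rewrite (proper_funE _ fp fu) (proper_funE _ fp fx) lee_fin => fux.
  have lam0 : 0 < lam by lra.
  by rewrite -(ler_pM2l lam0); rewrite -/E in fxE; lra.
have E0 : 0 <= nu * E by rewrite mulr_ge0 ?dotvv_ge0 ?ltW.
(* Small enough that the loss [lam * (nu * E)] is at most [e]; the summand [e *+ 2] keeps [lam]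
   below 1 even when [E] is 0. *)
pose lam := e / (nu * E + e *+ 2).
have lamE : lam * (nu * E + e *+ 2) = e by rewrite /lam divfK//; lra.
have lam01 : 0 < lam < 1.
  by rewrite divr_gt0 ?ltr_pdivrMr ?mul1r//=; lra.
have lamnuE : lam * (nu * E) <= e.
  have : 0 <= lam * e *+ 2 by rewrite mulrn_wge0// mulr_ge0; lra.
  lra.
by have := le_lam lam lam01; lra.
Qed.

End StrongConvexity.

(** * Linear tilts of the functional, and the Bregman distance *)

Section Tilt.
Context {R : realType} {n : nat}.
Variables (f : 'cV[R]_n -> \bar R) (nu : R).
Hypotheses (nu_gt0 : 0 < nu) (fp : proper_fun f).
Hypotheses (flsc : lower_semicontinuous f) (fsc : strongly_convex nu f).

Let tilt (zeta : 'cV[R]_n) u : \bar R := (f u - (dotv zeta u)%:E)%E.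

Let dom_tilt zeta : dom (tilt zeta) = dom f.
Proof.
by apply/seteqP; split=> u; rewrite /dom /tilt /=; case: (f u) => //= r; rewrite ?ltry.
Qed.

Let fine_tilt zeta u : dom f u -> fine (tilt zeta u) = fine (f u) - dotv zeta u.
Proof. by move=> /(proper_funE u fp) fu; rewrite /tilt fu. Qed.

Let proper_tilt zeta : proper_fun (tilt zeta).
Proof.
split; last by rewrite dom_tilt; exact: fp.2.
by move=> u; have := fp.1 u; rewrite /tilt; case: (f u).
Qed.

Let lower_semicontinuous_tilt zeta : lower_semicontinuous (tilt zeta).
Proof.
move=> u a; rewrite /tilt lteBrDr// -EFinD => au.
(* The margin [e] absorbs the variation of the linear term near [u]: half the gap if [f u] is
   finite, 1 if it is infinite. *)
have [e e0 ae] : exists2 e : R, 0 < e & ((a + dotv zeta u + e)%:E < f u)%E.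
  case: (f u) au => [r| |]//; last by exists 1; rewrite ?ltry.
  rewrite lte_fin => ar; exists ((r - (a + dotv zeta u)) / 2); first lra.
  by rewrite lte_fin; lra.
have [U Uu Uf] := flsc _ _ ae.
have FF := nbhs_filter u.
have Wu : \forall w \near u, dotv zeta w < dotv zeta u + e.
  by apply: (cvgr_lt _ (continuous_dotv zeta u)); rewrite ltrDl.
exists (U `&` [set w | dotv zeta w < dotv zeta u + e]); first exact: filterI.
move=> w [/Uf fw we].
rewrite [ltRHS]/(f w - (dotv zeta w)%:E)%E lteBrDr// -EFinD; apply: le_lt_trans fw.
by rewrite lee_fin -addrA lerD2l ltW.
Qed.

Let strongly_convex_tilt zeta : strongly_convex nu (tilt zeta).
Proof.
move=> u w lam; rewrite dom_tilt => fu fw lam01.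
have [fx] := strongly_convex_fine u w lam fp fsc fu fw lam01.
rewrite /tilt (proper_funE _ fp fu) (proper_funE _ fp fw) (proper_funE _ fp fx).
rewrite sqr_enorm -!EFinB -!EFinM -!EFinD lee_fin /= !dotvDr !dotvZr; lra.
Qed.

Lemma tilt_argminP zeta : minimizes_tilt f zeta (tilt_argmin f zeta).
Proof.
apply: (xgetPex 0 (P := [set u | minimizes_tilt f zeta u])).
exact: strongly_convex_argmin nu_gt0 (proper_tilt zeta)
  (@lower_semicontinuous_tilt zeta) (strongly_convex_tilt zeta).
Qed.

Lemma tilt_argmin_growth {zeta u w} : u = tilt_argmin f zeta -> dom f w ->
  dom f u /\
  fine (f u) - dotv zeta u + nu * dotv (w - u) (w - u)
    <= fine (f w) - dotv zeta w.
Proof.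
move=> -> fw; rewrite -(fine_tilt zeta w)//.
have [] := strongly_convex_growth _ w nu_gt0 (proper_tilt zeta)
  (strongly_convex_tilt zeta) (tilt_argminP zeta).
  by rewrite dom_tilt.
by rewrite dom_tilt => fu; rewrite fine_tilt.
Qed.

Definition bregman (uh zeta : 'cV[R]_n) : R :=
  let u := tilt_argmin f zeta in fine (f uh) - fine (f u) - dotv zeta (uh - u).

(** Quadratic growth of the tilted functional, evaluated at [uh], even bounds the distance below by
    nu |uh - u|^2. *)
Lemma bregman_ge0 uh zeta : dom f uh -> 0 <= bregman uh zeta.
Proof.
move=> fuh; have [_] := tilt_argmin_growth (erefl (tilt_argmin f zeta)) fuh.
rewrite /bregman; set u := tilt_argmin f zeta.
have := mulr_ge0 (ltW nu_gt0) (dotvv_ge0 (uh - u)).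
rewrite (dotvDr zeta) dotvNr; lra.
Qed.

(** Quadratic growth of the old tilt at the new minimizer [u'] leaves -<d, x> - nu |x|^2 with x = u'
    - u. Completing the square, |d + 2 nu x|^2 >= 0, bounds this by |d|^2 / (4 nu). *)
Lemma bregman_descent uh (zeta d : 'cV[R]_n) : dom f uh ->
  bregman uh (zeta - d) <= bregman uh zeta
    - dotv d (tilt_argmin f zeta - uh) + dotv d d / (4 * nu).
Proof.
move=> fuh; rewrite /bregman.
have [fu' _] := tilt_argmin_growth (erefl (tilt_argmin f (zeta - d))) fuh.
have [_] := tilt_argmin_growth (erefl (tilt_argmin f zeta)) fu'.
set u := tilt_argmin f zeta; set u' := tilt_argmin f (zeta - d).
have [x xE] : exists x, x = u' - u by exists (u' - u).
rewrite -xE => growth.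
have dx : dotv d x = dotv d u' - dotv d u by rewrite xE dotvDr dotvNr.
have : 0 <= dotv d d / (4 * nu) + dotv d x + nu * dotv x x.
  have nu4 : 0 < 4 * nu by rewrite mulr_gt0.
  rewrite -(pmulr_rge0 _ nu4); apply: le_trans (dotvv_ge0 (d + (2 * nu) *: x)) _.
  rewrite dotvDl !dotvDr !dotvZl !dotvZr (dotvC x d).
  by rewrite le_eqVlt; apply/orP; left; apply/eqP; field; rewrite gt_eqF.
rewrite !(dotvDl, dotvDr, dotvNl, dotvNr); lra.
Qed.

End Tilt.

(** * Descent of the Bregman distance along the iterates *)

Section Descent.
Context {R : realType} {n l q : nat}.
Variables (D : riat_input R n l q) (nu : R) (v : 'I_q -> 'cV[R]_n).
Variable uh : 'cV[R]_n.

Local Notation f := (in_f D).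
Local Notation V := (in_V D).
Local Notation H := (in_H D).
Local Notation tau := (in_tau D).
Local Notation mu0 := (in_mu0 D).
Local Notation mu1 := (in_mu1 D).
Local Notation E := (bregman f uh).

Hypotheses (nu_gt0 : 0 < nu) (f_proper : proper_fun f).
Hypotheses (f_lsc : lower_semicontinuous f) (f_convex : strongly_convex nu f).
Hypothesis delta_gt0 : forall i, 0 < in_delta D i.
Hypothesis noise : forall i, enorm (in_vd D i - v i) <= in_delta D i.
Hypothesis V_orthonormal : forall i, (V i)^T *m V i = 1%:M.
Hypothesis uh_dom : dom f uh.
Hypothesis uh_sol : forall i, arnoldi_approx (V i) (H i) *m uh = v i.
Hypotheses (tau_gt1 : 1 < tau) (mu0_gt0 : 0 < mu0) (mu1_gt0 : 0 < mu1).
Hypothesis param : 0 < 1 - tau^-1 - mu0 / (4 * nu).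
Hypothesis gamma_gt0 : forall j, 0 < in_gamma D j.
Hypothesis gamma_decr : nonincreasing_seq (in_gamma D).

Let c : R := 1 - tau^-1 - mu0 / (4 * nu).

(** One summand of [g_outer]; for positive [g] it is also the inner direction, by [g_innerE], so
    both kinds of update share one analysis. *)
Definition direction g i u : 'cV[R]_n :=
  firstcols (V i) *m (H i)^T *m invsqrtmx (Amx D g i) *m hvec D g i u.

Lemma posdefmx_Amx g i : 0 < g -> posdefmx (Amx D g i).
Proof.
move=> g0; split=> [|x x0].
  by rewrite /Amx linearD/= tr_scalar_mx trmx_mul trmxK.
rewrite /Amx mulmxDl mul_scalar_mx dotvDr dotvZr -mulmxA.
rewrite -{1}[H i]trmxK -dotv_mulmxl.
by rewrite ltr_wpDr ?dotvv_ge0// mulr_gt0// dotvv_gt0.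
Qed.

(** Here y = A^(1/2) z, so |y|^2 = <z, A z>. Dropping one summand bounds the direction, dropping the
    other bounds the transformed noise. *)
Lemma dotv_invsqrt_Amx g i (y : 'cV[R]_l.+1) : 0 < g ->
  let z := invsqrtmx (Amx D g i) *m y in
  dotv y y = g * dotv z z + dotv ((H i)^T *m z) ((H i)^T *m z).
Proof.
move=> g0 z; have Apos := posdefmx_Amx g i g0.
have [[BT _] BB] := invsqrtmxP Apos.
have BAB : invsqrtmx (Amx D g i) *m (Amx D g i *m invsqrtmx (Amx D g i)) = 1%:M.
  rewrite mulmxA; apply: mulmx1C; rewrite mulmxA BB.
  exact: mulVmx (posdefmx_unit Apos).
rewrite -{2}[y]mul1mx -BAB -!mulmxA -/z -{1}BT -dotv_mulmxl -/z.
rewrite {1}/Amx mulmxDl mul_scalar_mx dotvDr dotvZr -mulmxA.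
by rewrite -{1}[H i]trmxK -dotv_mulmxl.
Qed.

Lemma g_innerE g i u : 0 < g -> g_inner D g i u = direction g i u.
Proof.
move=> g0; rewrite /g_inner /direction /hvec.
by rewrite -(invsqrtmxP (posdefmx_Amx g i g0)).2 !mulmxA.
Qed.

Lemma firstcols_orthonormal i : (firstcols (V i))^T *m firstcols (V i) = 1%:M.
Proof.
apply/matrixP => a b; have /matrixP/(_ (widen_ord (leqnSn l) a)) := V_orthonormal i.
move=> /(_ (widen_ord (leqnSn l) b)); rewrite !mxE -val_eqE /= => <-.
by apply: eq_bigr => k _; rewrite !mxE.
Qed.

Lemma dotv_direction_le g i u : 0 < g ->
  dotv (direction g i u) (direction g i u) <= dotv (hvec D g i u) (hvec D g i u).
Proof.
move=> g0; rewrite /direction -!mulmxA dotv_mulmxl [X in dotv _ X]mulmxA.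
rewrite firstcols_orthonormal mul1mx.
rewrite [leRHS](dotv_invsqrt_Amx g i _ g0) lerDr.
by rewrite mulr_ge0 ?dotvv_ge0// ltW.
Qed.

(** Links the error [u - uh] to the computed residual: the left side is the projected residual for
    the exact data [v i], because [uh] solves that system. *)
Lemma proj_residualE i u :
  H i *m ((firstcols (V i))^T *m (u - uh)) =
  proj_residual D i u + (V i)^T *m (in_vd D i - v i).
Proof.
rewrite /proj_residual -mulmxDr addrA subrK -(uh_sol i) -mulmxBr.
by rewrite /arnoldi_approx !mulmxA V_orthonormal mul1mx.
Qed.

(* An active equation has [enorm h > tau * delta_i / sqrt g], so the data error
   seen through [invsqrtmx] is at most [enorm h / tau]. *)
Lemma direction_angle g i u : 0 < g -> active D g u i ->
  (1 - tau^-1) * enorm (hvec D g i u) ^+ 2 <= dotv (direction g i u) (u - uh).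
Proof.
move=> g0; rewrite /active /direction; set h := hvec D g i u => act.
have [[BT _] _] := invsqrtmxP (posdefmx_Amx g i g0).
(* Transposing the factors of the direction turns its product with [u - uh] into <h, h + w>, where
   [w] is the transformed noise. *)
rewrite -!mulmxA 3!dotv_mulmxl trmxK BT.
rewrite proj_residualE mulmxDr dotvDr.
rewrite -/(hvec D g i u) -/h -sqr_enorm.
set w := _ *m (_ *m (in_vd D i - v i)).
have tau0 : 0 < tau by exact: lt_trans ltr01 tau_gt1.
have gw : g * enorm w ^+ 2 <= in_delta D i ^+ 2.
  have e_le : enorm ((V i)^T *m (in_vd D i - v i)) <= in_delta D i.
    exact: le_trans (enorm_trmx_le _ _ (V_orthonormal i)) (noise i).
  apply: (@le_trans _ _ (enorm ((V i)^T *m (in_vd D i - v i)) ^+ 2)).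
    by rewrite !sqr_enorm [leRHS](dotv_invsqrt_Amx g i _ g0) lerDl dotvv_ge0.
  by rewrite ler_sqr ?nnegrE ?enorm_ge0// ltW.
have wh : enorm w <= tau^-1 * enorm h.
  rewrite -ler_pdivrMl ?invr_gt0// invrK -ler_sqr ?nnegrE ?enorm_ge0//; last first.
    by rewrite mulr_ge0 ?enorm_ge0// ltW.
  rewrite -(ler_pM2l g0) exprMn mulrCA (le_trans _ (ltW act))//.
  by rewrite ler_wpM2l// sqr_ge0.
have := cauchy_schwarz h (- w).
rewrite dotvNr {2}/enorm dotvNl dotvNr opprK -/(enorm w).
have := ler_wpM2l (enorm_ge0 h) wh; lra.
Qed.

Lemma stepsize_ge0 num d : 0 <= num -> 0 <= stepsize D num d.
Proof.
move=> num0; rewrite /stepsize; case: ifP => _; first exact: ltW.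
by rewrite le_min (ltW mu1_gt0) andbT divr_ge0 ?sqr_ge0// mulr_ge0// ltW.
Qed.

Lemma stepsize_sqr_le num d : 0 <= num ->
  stepsize D num d * dotv d d <= mu0 * num.
Proof.
move=> num0; rewrite /stepsize; case: eqVneq => [->|d0].
  by rewrite dotv0 mulr0 mulr_ge0// ltW.
by rewrite -ler_pdivlMr ?dotvv_gt0// sqr_enorm ge_min lexx.
Qed.

Lemma stepsize_lbound num d : dotv d d <= q%:R * num ->
  Num.min (mu0 / q%:R) mu1 <= stepsize D num d.
Proof.
rewrite /stepsize; case: eqVneq => [_ _|d0 dq]; first by rewrite ge_min lexx orbT.
have dd : 0 < dotv d d by rewrite dotvv_gt0.
(* With [q = 0] the assumed bound on [dotv d d] would force [d = 0]. *)
have q0 : 0 < q%:R :> R.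
  rewrite lt0r ler0n andbT; apply: contraTneq dd => q0.
  by rewrite -leNgt (le_trans dq)// q0 mul0r.
rewrite le_min !ge_min lexx orbT andbT sqr_enorm; apply/orP; left.
by rewrite ler_pdivlMr// mulrAC ler_pdivrMr// -mulrA ler_pM2l// mulrC.
Qed.

(** * A single update built from a set [Q] of active equations *)

Section Update.
Variables (g : R) (u : 'cV[R]_n) (Q : pred 'I_q).
Hypotheses (g_gt0 : 0 < g) (Q_active : forall i, Q i -> active D g u i).

Let G := \sum_(i | Q i) direction g i u.
Let Phi := \sum_(i | Q i) enorm (hvec D g i u) ^+ 2.

Let Phi_ge0 : 0 <= Phi.
Proof. by apply: sumr_ge0 => i _; exact: sqr_ge0. Qed.

Lemma dotv_direction_sum_le : dotv G G <= q%:R * Phi.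
Proof.
rewrite (le_trans (dotv_sum_le _ _ _))// card_ord ler_wpM2l//.
by apply: ler_sum => i _; rewrite sqr_enorm dotv_direction_le.
Qed.

(** Used with [Q] the singleton of the drawn index for inner updates, and with all active indices
    for outer ones. *)
Lemma update_descent zeta : u = tilt_argmin f zeta ->
  E (zeta - stepsize D Phi G *: G) <= E zeta - c * (stepsize D Phi G * Phi).
Proof.
move=> uE; set t := stepsize _ _ _.
have t0 : 0 <= t by exact: stepsize_ge0.
apply: le_trans (bregman_descent _ _ nu_gt0 f_proper f_lsc f_convex _ _ _ uh_dom) _.
rewrite -uE dotvZl (dotvZl _ _ (t *: G)) dotvZr.
have angle : (1 - tau^-1) * Phi <= dotv G (u - uh).
  rewrite dotv_suml mulr_sumr; apply: ler_sum => i Qi.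
  exact/direction_angle/Q_active.
have tG : t * (t * dotv G G) / (4 * nu) <= t * (mu0 * Phi) / (4 * nu).
  apply: ler_wpM2r; first by rewrite invr_ge0 mulr_ge0// ltW.
  by apply: ler_wpM2l => //; exact: stepsize_sqr_le.
have := ler_wpM2l t0 angle.
rewrite /c; lra.
Qed.

End Update.

(** An inactive draw leaves the iterate unchanged and an active one falls under [update_descent];
    keeping only the sign of the decrease makes the bound valid for any draws. *)
Lemma inner_loop_bregman k z j : E (inner_loop D k z j) <= E z.
Proof.
elim: j => //= j; apply: le_trans.
set zj := inner_loop D k z j; set g := gamma_inner D k j.
set i := in_draw D k j; rewrite /t_inner; set u := tilt_argmin f zj.
case: ifPn => [act|_]; last by rewrite scale0r subr0.
have g0 : 0 < g by exact: gamma_gt0.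
have Qact a : pred1 i a -> active D g u a by move=> /eqP ->.
have := update_descent _ _ _ g0 Qact zj erefl.
rewrite !big_pred1_eq g_innerE// => /le_trans; apply.
rewrite gerBl mulr_ge0 ?(ltW param)// mulr_ge0 ?sqr_ge0//.
by apply: stepsize_ge0; exact: sqr_ge0.
Qed.

(** Step size and Phi are bounded below separately, Phi by the term of one violated equation. The
    common noise bound [d] and the first gamma make the decrease independent of [k]. *)
Lemma outer_update_bregman k : (0 < k)%N -> ~ stop_at D k -> forall d, 0 <= d ->
  (forall i, d <= in_delta D i) ->
  E (outer_update D k (zeta_outer D k)) <= E (zeta_outer D k)
    - c * (Num.min (mu0 / q%:R) mu1 * (tau ^+ 2 * d ^+ 2 / in_gamma D 0%N)).
Proof.
move=> k0 nstop d d0 d_min; rewrite /outer_update.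
set g := gamma_outer D k; set z := zeta_outer D k.
have g0 : 0 < g by exact: gamma_gt0.
rewrite /t_outer /Phi_outer /g_outer.
apply: le_trans (update_descent _ _ _ g0 (fun=> id) z erefl) _.
rewrite lerD2l lerN2 ler_wpM2l ?(ltW param)//.
have min0 : 0 <= Num.min (mu0 / q%:R) mu1.
  by rewrite le_min divr_ge0 ?(ltW mu0_gt0) ?(ltW mu1_gt0).
apply: ler_pM => //.
- by rewrite divr_ge0 ?(ltW (gamma_gt0 _))// mulr_ge0 ?sqr_ge0.
- by apply: stepsize_lbound; exact: dotv_direction_sum_le.
move: nstop; rewrite /stop_at => /existsNP[i /negP]; rewrite -ltNge => act.
rewrite (bigD1 i)//= ler_wpDr//.
  by apply: sumr_ge0 => a _; exact: sqr_ge0.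
apply: (@le_trans _ _ (tau ^+ 2 * in_delta D i ^+ 2 / g)).
  apply: ler_pM.
  - by rewrite mulr_ge0 ?sqr_ge0.
  - by rewrite invr_ge0 ltW.
  - by rewrite ler_wpM2l ?sqr_ge0// ler_sqr ?nnegrE// (le_trans d0).
  - by rewrite lef_pV2 ?posrE//; exact: gamma_decr.
by rewrite ler_pdivrMr// [leRHS]mulrC; exact: ltW.
Qed.

Lemma riat_terminates_of_descent : (0 < q)%N -> riat_terminates D.
Proof.
move=> q0; apply: contrapT => nterm.
have nstop k : (0 < k)%N -> ~ stop_at D k by move=> k0 ?; apply: nterm; exists k.
(* The smallest noise level, capped at 1; positive as a minimum of finitely many positive
   numbers. *)
pose d := \big[Num.min/1]_i in_delta D i.
have d0 : 0 < d by apply: lt_bigmin.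
have d_min i : d <= in_delta D i by exact: bigmin_le_cond.
pose s := c * (Num.min (mu0 / q%:R) mu1 * (tau ^+ 2 * d ^+ 2 / in_gamma D 0%N)).
have s0 : 0 < s.
  apply: mulr_gt0 => //; apply: mulr_gt0.
    by rewrite lt_min mu1_gt0 divr_gt0 ?ltr0n.
  by rewrite divr_gt0// mulr_gt0 ?exprn_gt0// (lt_trans ltr01).
(* Start [k.+1] is obtained from start [k] by the inner loop of pass [k], which does not raise [E],
   and then outer update number [k.+1], which lowers it by [s]. *)
have descent k : E (zeta_start D k) <= E (in_zeta0 D) - k%:R * s.
  elim: k => [|k IH] /=; first by rewrite mul0r subr0.
  have := outer_update_bregman k.+1 isT (nstop k.+1 isT) d (ltW d0) d_min.
  move=> /le_trans; apply; rewrite -/s -natr1 mulrDl mul1r opprD addrA lerD2r.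
  exact: le_trans (inner_loop_bregman _ _ _) IH.
have [k kE] : exists k : nat, E (in_zeta0 D) / s < k%:R.
  by exists (Num.truncn (E (in_zeta0 D) / s)).+1; exact: truncnS_gt.
have := bregman_ge0 _ _ nu_gt0 f_proper f_lsc f_convex uh (zeta_start D k) uh_dom.
apply/negP; rewrite -ltNge; apply: le_lt_trans (descent k) _.
by rewrite subr_lt0 -ltr_pdivrMr.
Qed.

End Descent.

Theorem lemma5p2 (R : realType) (n l q : nat)
    (l_gt0 : (0 < l)%N) (l_lt_n : (l < n)%N) (q_gt0 : (0 < q)%N)
    (* functional *)
    (f : 'cV[R]_n -> \bar R) (nu : R) (nu_gt0 : 0 < nu)
    (f_proper : proper_fun f) (f_lsc : lower_semicontinuous f)
    (f_convex : strongly_convex nu f)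
    (* data *)
    (T : 'I_q -> 'M[R]_n) (v vd : 'I_q -> 'cV[R]_n) (delta : 'I_q -> R)
    (delta_gt0 : forall i, 0 < delta i)
    (noise : forall i, enorm (vd i - v i) <= delta i)
    (* Arnoldi projected systems *)
    (V : 'I_q -> 'M[R]_(n, l.+1)) (H : 'I_q -> 'M[R]_(l.+1, l))
    (VH : forall i, arnoldi (T i) (vd i) (V i) (H i))
    (solvable : exists2 u, dom f u &
                  forall i, arnoldi_approx (V i) (H i) *m u = v i)
    (* regularization parameters *)
    (gamma : nat -> R) (gamma_gt0 : forall j, 0 < gamma j)
    (gamma_decr : nonincreasing_seq gamma)
    (gamma_sum : series (fun j => (gamma j)^-1) @ \oo --> +oo)
    (* parameters of the algorithm *)
    (tau mu0 mu1 : R) (tau_gt1 : 1 < tau) (mu0_gt0 : 0 < mu0)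
    (mu1_gt0 : 0 < mu1)
    (zeta0 : 'cV[R]_n) (m : nat -> nat) (m_gt0 : forall k, (0 < m k)%N)
    (param : 0 < 1 - tau^-1 - mu0 / (4 * nu)) :
  (* for every realization of the random draws *)
  forall draw : nat -> nat -> 'I_q,
    riat_terminates
      (RiatInput f V H vd delta gamma tau mu0 mu1 zeta0 m draw).
Proof.
move=> draw; have [uh uh_dom uh_sol] := solvable.
apply: (riat_terminates_of_descent _ nu v uh) => //= i.
exact: arnoldi_orthonormal (VH i).
Qed.
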